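(* Let $n$ and $k$ be integers with $k$ even, $k\ge 2$ and $n\ge\frac{k^2}{2}+k-2$. Then $$\mathrm{bbal}(n,K_{1,k})=\mathrm{bbal}(n,K_{1,k+1})=(k-2)\left(n-\frac{k-2}{4}\right),$$ and $\mathrm{Bbal}(n,K_{1,k})=\mathrm{Bbal}(n,K_{1,k+1})$ contains only one graph, namely the bipartite graph $H$ with partition sets $X$ and $Y$, where $X=X_1\sqcup X_2$ and $Y=Y_1\sqcup Y_2$ with $|X_1|=|Y_2|=n-\frac{k-2}{2}$ and $|X_2|=|Y_1|=\frac{k-2}{2}$, whose edges are all possible edges between $X_1$ and $Y_1$ and all possible edges between $X_2$ and $Y$.
   Context: $K_{1,k}$ is the star with $k$ edges. A $2$-edge coloring of $K_{n,n}$ is a partition $E(K_{n,n})=R\sqcup B$ into red edges $R$ and blue edges $B$. A balanced copy of a graph $G$ in such a coloring is a (not necessarily induced) subgraph of $K_{n,n}$ isomorphic to $G$ whose numbers of red and blue edges differ by at most $1$. For a bipartite graph $G$, the bipartite balancing number $\mathrm{bbal}(n,G)$ is the smallest integer $k$ with $0\le k<\lfloor n^2/2\rfloor$ (if it exists) such that every $2$-edge coloring $E(K_{n,n})=R\sqcup B$ with $|R|>k$ and $|B|>k$ contains a balanced copy of $G$. $\mathrm{Bbal}(n,G)$ is the family of graphs with exactly $\mathrm{bbal}(n,G)$ edges such that a $2$-edge coloring $E(K_{n,n})=R\sqcup B$ with at least $\mathrm{bbal}(n,G)$ edges in each color and exactly $\mathrm{bbal}(n,G)$ edges in one color contains no balanced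 copy of $G$ if and only if the graph induced by the red edges or the graph induced by the blue edges is isomorphic to some $H\in\mathrm{Bbal}(n,G)$. Here graphs are considered up to isomorphism and up to isolated vertices.
   Formalization: The claims about K_{1,k+1} exclude the single case n = k = 2, where K_{2,2} contains no K_{1,3}, so bbal(2,K_{1,3}) does not exist; the claims about K_{1,k} are kept for all n and k. *)

(* Defs.v *)
From mathcomp Require Import all_boot all_order all_algebra.

Set Implicit Arguments.
Unset Strict Implicit.
Unset Printing Implicit Defensive.

Record sgraph := SGraph {
  vertex :> finType;
  adj : rel vertex;
  adj_sym : symmetric adj;
  adj_irr : irreflexive adj }.

(* Edges are unordered pairs, so #|edges G| is the number of edges of G. *)
Definition edges (G : sgraph) : {set {set G}} :=
  [set [set p.1; p.2] | p : G * G & adj p.1 p.2].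

Section Bipartite.
Variables (X Y : finType) (r : X -> Y -> bool).

Definition bip_adj (u v : X + Y) : bool :=
  match u, v with
  | inl x, inr y => r x y
  | inr y, inl x => r x y
  | _, _ => false
  end.

Lemma bip_adj_sym : symmetric bip_adj.
Proof. by case=> [x|y] [x'|y']. Qed.

Lemma bip_adj_irr : irreflexive bip_adj.
Proof. by case. Qed.

Definition bip_graph := SGraph bip_adj_sym bip_adj_irr.
End Bipartite.

Definition complete_bip (m n : nat) : sgraph :=
  bip_graph (fun (_ : 'I_m) (_ : 'I_n) => true).

Definition Knn (n : nat) : sgraph := complete_bip n n.
Definition star (k : nat) : sgraph := complete_bip 1 k.

Section GraphOfEdges.
Variables (V : finType) (S : {set {set V}}).

Definition edge_adj (x y : V) : bool := (x != y) && ([set x; y] \in S).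

Lemma edge_adj_sym : symmetric edge_adj.
Proof. by move=> x y; rewrite /edge_adj eq_sym setUC. Qed.

Lemma edge_adj_irr : irreflexive edge_adj.
Proof. by move=> x; rewrite /edge_adj eqxx. Qed.

Definition graph_of_edges := SGraph edge_adj_sym edge_adj_irr.
End GraphOfEdges.

Section Core.
Variable G : sgraph.

Definition core_vertex : finType := {x : G | [exists y, adj x y]}.
Definition core_adj (u v : core_vertex) : bool := adj (val u) (val v).

Lemma core_adj_sym : symmetric core_adj.
Proof. by move=> u v; apply: adj_sym. Qed.

Lemma core_adj_irr : irreflexive core_adj.
Proof. by move=> u; apply: adj_irr. Qed.

(* G with its isolated vertices deleted. *)
Definition core := SGraph core_adj_sym core_adj_irr.
End Core.

Definition graph_iso (G H : sgraph) : Prop :=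
  exists2 f : G -> H, bijective f & forall x y, adj (f x) (f y) = adj x y.

(* Isomorphism up to isolated vertices. *)
Definition same_graph (G H : sgraph) : Prop := graph_iso (core G) (core H).

Definition coloring (n : nat) (R B : {set {set Knn n}}) : bool :=
  (R :|: B == edges (Knn n)) && [disjoint R & B].

(* A copy of G is the image of G under an injection of its vertices into those
   of K_{n,n} that sends edges to edges; C is the edge set of the copy. *)
Definition has_balanced_copy (n : nat) (G : sgraph)
    (R B : {set {set Knn n}}) : bool :=
  [exists f : {ffun G -> Knn n},
    let C := [set f @: e | e : {set G} in edges G] in
    [&& injectiveb f, C \subset edges (Knn n),
        #|C :&: R| <= #|C :&: B|.+1 & #|C :&: B| <= #|C :&: R|.+1]].

Definition forces_balanced (n : nat) (G : sgraph) (j : nat) : bool :=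
  [forall R : {set {set Knn n}}, forall B : {set {set Knn n}},
    [&& coloring R B, j < #|R| & j < #|B|] ==> has_balanced_copy G R B].

(* The smallest j < floor(n^2 / 2) that forces a balanced copy; None if there
   is no such j. *)
Definition bbal (n : nat) (G : sgraph) : option nat :=
  ohead [seq j <- iota 0 (n ^ 2 %/ 2) | forces_balanced n G j].

(* F is the family Bbal(n, G), given as the class of all representatives of its
   members, hence closed under same_graph. A graph that is not a subgraph of
   K_{n,n} is never the graph of a color, and the equivalence below would not
   constrain it; such graphs are excluded so that F is determined by (n, G). *)
Definition is_Bbal (n : nat) (G : sgraph) (F : sgraph -> Prop) : Prop :=
  exists2 b, bbal n G = Some b &
  [/\ forall J J', same_graph J J' -> F J -> F J',
      forall J, F J -> #|edges J| = b,
      forall J, F J -> exists2 S : {set {set Knn n}},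
        S \subset edges (Knn n) & same_graph J (graph_of_edges S) &
      forall R B : {set {set Knn n}},
        coloring R B -> b <= #|R| -> b <= #|B| -> #|R| = b \/ #|B| = b ->
        (~ has_balanced_copy G R B <->
         exists2 J, F J & same_graph (graph_of_edges R) J \/
                          same_graph (graph_of_edges B) J)].

Definition only_member (H : sgraph) (F : sgraph -> Prop) : Prop :=
  forall J, F J <-> same_graph J H.

(* X = X1 + X2 with |X1| = n - m, |X2| = m, and Y = Y1 + Y2 with |Y1| = m,
   |Y2| = n - m. *)
Definition extremal_graph (n m : nat) : sgraph :=
  bip_graph (fun (x : 'I_(n - m) + 'I_m) (y : 'I_m + 'I_(n - m)) =>
    match x, y with
    | inl _, inl _ => true
    | inl _, inr _ => false
    | inr _, _ => true
    end).

(* Main.v *)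
(* Write k = 2m + 2.  A coloring has no balanced star with k (or k + 1) edges iff
   every vertex has red or blue degree at most m.  Let P and Q be the sets of
   vertices of red degree > m on the two sides.  Double counting the red and
   blue edges between P and the complement of Q gives
   |P| |Q^c| <= m (|P| + |Q^c|), and likewise for P^c and Q; for n this large
   these two inequalities leave only |P|, |Q| <= m or |P^c|, |Q^c| <= m.  In the
   first case the red edges number at most |P| n + (n - |P|) m <=
   n^2 - (n - m)^2, with equality iff |P| = |Q| = m and the red edges are exactly
   those meeting P or Q, which is the extremal graph. *)
Require Import Defs.
From mathcomp Require Import all_boot all_order all_algebra.
From mathcomp Require Import zify ring.
Import GRing.Theory.

Set Implicit Arguments.
Unset Strict Implicit.
Unset Printing Implicit Defensive.

(** * Graphs up to isolated vertices *)

Lemma set2_inj (T : finType) (v : T) : injective (fun u => [set v; u]).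
Proof.
move=> u u' /= E; have: u \in [set v; u'] by rewrite -E set22.
have: u' \in [set v; u] by rewrite E set22.
by rewrite !inE => /orP[]/eqP-> // /orP[]/eqP.
Qed.

Lemma mem_edges (G : sgraph) (x y : G) : ([set x; y] \in edges G) = adj x y.
Proof.
apply/imsetP/idP=> [[[a b]]|xy]; last by exists (x, y); rewrite ?inE.
rewrite inE /= => ab E; have: x \in [set a; b] by rewrite -E set21.
rewrite !inE => /orP[]/eqP xE; move: E; rewrite xE; first by move/set2_inj->.
by rewrite [RHS]setUC => /set2_inj ->; rewrite adj_sym.
Qed.

Definition nb (G : sgraph) (v : G) : {set G} := [set u | adj v u].

(** By the last clause [f] misses only isolated vertices of [H], so edge counts and the degrees of
    vertices in the image carry over. *)
Definition full_embedding (G H : sgraph) (f : G -> H) : Prop :=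
  [/\ injective f, forall x y, adj (f x) (f y) = adj x y &
      forall u v, adj u v -> u \in codom f].

Section FullEmbedding.
Variables (G H : sgraph) (f : G -> H).
Hypothesis f_emb : full_embedding f.

Lemma card_edges_embedding : #|edges G| = #|edges H|.
Proof.
have [f_inj f_adj f_full] := f_emb.
rewrite -(card_imset (mem (edges G)) (imset_inj f_inj)).
congr #|pred_of_set _|; apply/setP=> A; apply/imsetP/imsetP.
  case=> _ /imsetP[[x y] +] -> ->; rewrite inE /= => xy.
  by exists (f x, f y); rewrite ?inE /= ?f_adj // imsetU !imset_set1.
case=> [[u v]]; rewrite inE /= => uv ->.
have /codomP[x xE] := f_full _ _ uv.
have /codomP[y yE] : v \in codom f by apply: (f_full v u); rewrite adj_sym.
exists [set x; y]; last by rewrite imsetU !imset_set1 xE yE.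
by rewrite mem_edges -f_adj -xE -yE.
Qed.

Lemma card_nb_embedding (x : G) : #|nb (f x)| = #|nb x|.
Proof.
have [f_inj f_adj f_full] := f_emb.
rewrite -(card_imset (mem (nb x)) f_inj); congr #|pred_of_set _|.
apply/setP=> u; rewrite inE; apply/idP/imsetP=> [xu|[y + ->]].
  have /codomP[y yE] : u \in codom f by apply: (f_full u (f x)); rewrite adj_sym.
  by exists y => //; rewrite inE -f_adj -yE.
by rewrite inE f_adj.
Qed.

End FullEmbedding.

Lemma core_embedding (G : sgraph) : full_embedding (fun u : core G => val u).
Proof.
split=> [|//|u v uv]; first exact: val_inj.
have uP : [exists y, adj u y] by apply/existsP; exists v.
by apply/codomP; exists (Sub u uP : core_vertex G).
Qed.

(** Only [core G] is mapped: an isolated vertex of [G] need not have a counterpart in [H]. *)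
Lemma same_graph_embedding (G H : sgraph) : same_graph G H ->
  exists f : core G -> H, full_embedding f.
Proof.
case=> f [g fK gK] f_adj; exists (fun u => val (f u)).
split=> [||u v uv]; first exact: inj_comp val_inj (can_inj fK).
  by move=> x y; rewrite -f_adj.
have [_ _ H_full] := core_embedding H.
have /codomP[w wE] := H_full u v uv.
by apply/codomP; exists (g w); rewrite gK.
Qed.

Lemma same_graph_card_edges (G H : sgraph) :
  same_graph G H -> #|edges G| = #|edges H|.
Proof.
case/same_graph_embedding=> f f_emb.
rewrite -(card_edges_embedding f_emb).
by rewrite (card_edges_embedding (core_embedding G)).
Qed.

Lemma same_graph_card_nb (G H : sgraph) (v : G) : same_graph G H ->
  nb v = set0 \/ exists w : H, #|nb w| = #|nb v|.
Proof.
case/same_graph_embedding=> f f_emb.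
have [->|[u]] := set_0Vmem (nb v); [by left | rewrite inE => vu; right].
have [_ _ G_full] := core_embedding G; have /codomP[w ->] := G_full v u vu.
exists (f w); rewrite (card_nb_embedding f_emb).
by rewrite (card_nb_embedding (core_embedding G)).
Qed.

Lemma graph_iso_same (G H : sgraph) : graph_iso G H -> same_graph G H.
Proof.
case=> f [g fK gK] f_adj.
have g_adj x y : adj (g x) (g y) = adj x y by rewrite -f_adj !gK.
have fP (u : core G) : [exists y, adj (f (val u)) y].
  by case/existsP: (valP u) => y uy; apply/existsP; exists (f y); rewrite f_adj.
have gP (u : core H) : [exists y, adj (g (val u)) y].
  by case/existsP: (valP u) => y uy; apply/existsP; exists (g y); rewrite g_adj.
exists (fun u => Sub (f (val u)) (fP u) : core_vertex H) => [|x y].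
  exists (fun u => Sub (g (val u)) (gP u) : core_vertex G) => u;
    by apply: val_inj; rewrite /= ?fK ?gK.
exact: f_adj.
Qed.

Lemma same_graph_sym (G H : sgraph) : same_graph G H -> same_graph H G.
Proof.
case=> f [g fK gK] f_adj; exists g; first by exists f.
by move=> x y; rewrite -f_adj !gK.
Qed.

Lemma same_graph_trans (G H K : sgraph) :
  same_graph G H -> same_graph H K -> same_graph G K.
Proof.
case=> f f_bij f_adj [g g_bij g_adj]; exists (g \o f); first exact: bij_comp.
by move=> x y; rewrite -f_adj -g_adj.
Qed.

(** * Balanced stars *)

Definition nbr (T : finType) (S : {set {set T}}) (v : T) : {set T} :=
  [set u | [set v; u] \in S].

Lemma card_imsetI (T U : finType) (f : T -> U) (A : {set T}) (B : {set U}) :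
  injective f -> #|(f @: A) :&: B| = #|A :&: f @^-1: B|.
Proof.
move=> f_inj; rewrite -[RHS](card_imset _ f_inj); congr #|pred_of_set _|.
apply/setP=> u; rewrite !inE; apply/andP/imsetP=> [[/imsetP[x xA ->] fxB]|[x]].
  by exists x => //; rewrite !inE xA.
by rewrite !inE => /andP[xA fxB] ->; rewrite imset_f.
Qed.

(** A copy of a star is described by its center and its set of leaves. As [fun u => [set v; u]] is
    injective, counting edges of a color becomes counting leaves. *)
Lemma star_edges_image (T : finType) (s : nat) (f : star s -> T) :
  [set f @: e | e : {set star s} in edges (star s)] =
  [set [set f (inl ord0); u] | u in [set f (inr j) | j : 'I_s]].
Proof.
apply/setP=> A; apply/imsetP/imsetP=> [[_ /imsetP[[u v] + ->] ->]|].
  have fE (i : 'I_1) : f (inl i) = f (inl ord0) by rewrite ord1.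
  rewrite inE /= imsetU !imset_set1; case: u v => [i|j] [i'|j'] //= _.
    by exists (f (inr j')); rewrite ?imset_f // fE.
  by exists (f (inr j)); rewrite ?imset_f // fE setUC.
case=> _ /imsetP[j _ ->] ->; exists [set inl ord0; inr j].
  by rewrite mem_edges.
by rewrite imsetU !imset_set1.
Qed.

Lemma has_balanced_copy_starP (n s : nat) (R B : {set {set Knn n}}) :
  has_balanced_copy (star s) R B <->
  exists v, exists2 N : {set Knn n}, N \subset nb v /\ #|N| = s &
    #|N :&: nbr R v| <= #|N :&: nbr B v|.+1 /\
    #|N :&: nbr B v| <= #|N :&: nbr R v|.+1.
Proof.
have nbE (v : Knn n) : nb v = (fun u => [set v; u]) @^-1: edges (Knn n).
  by apply/setP=> u; rewrite !inE mem_edges.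
have nbrE (v : Knn n) (S : {set {set Knn n}}) :
    (fun u => [set v; u]) @^-1: S = nbr S v by apply/setP=> u; rewrite !inE.
split.
  case/existsP=> f /=; rewrite star_edges_image sub_imset_pre -nbE.
  rewrite !card_imsetI ?nbrE; try exact: set2_inj.
  case/and4P=> /injectiveP f_inj sub RB BR.
  exists (f (inl ord0)), [set f (inr j) | j : 'I_s] => //; split=> //.
  by rewrite card_imset ?card_ord // => i j /f_inj[].
case=> v [N [sub Ns] [RB BR]].
pose f : {ffun star s -> Knn n} := [ffun u : star s => match u with
  | inl _ => v | inr j => enum_val (cast_ord (esym Ns) j) end].
have fl i : f (inl i) = v by rewrite ffunE.
have fr j : f (inr j) = enum_val (cast_ord (esym Ns) j) by rewrite ffunE.
have frN j : f (inr j) \in N by rewrite fr enum_valP.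
have vN : v \notin N.
  by apply/negP=> /(subsetP sub); rewrite inE adj_irr.
have frE : [set f (inr j) | j : 'I_s] = N.
  apply/setP=> u; apply/imsetP/idP=> [[j _ ->] //|uN].
  exists (cast_ord Ns (enum_rank_in uN u)) => //.
  by rewrite fr cast_ordK enum_rankK_in.
apply/existsP; exists f; rewrite /= star_edges_image sub_imset_pre -nbE.
rewrite !card_imsetI ?nbrE; try exact: set2_inj.
rewrite frE fl sub RB BR !andbT; apply/injectiveP=> -[i|j] [i'|j'].
- by rewrite (ord1 i) (ord1 i').
- by rewrite fl => E; rewrite E frN in vN.
- by rewrite fl => E; rewrite -E frN in vN.
- by rewrite !fr => /enum_val_inj/cast_ord_inj ->.
Qed.

(** * The two color classes at a vertex *)

Section Coloring.
Variables (n : nat) (R B : {set {set Knn n}}).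
Hypothesis RB_coloring : coloring R B.

Lemma coloring_sym : coloring B R.
Proof. by rewrite /coloring setUC disjoint_sym. Qed.

Lemma coloring_subset : R \subset edges (Knn n).
Proof. by case/andP: RB_coloring => /eqP<- _; apply: subsetUl. Qed.

Lemma coloring_complement : B = edges (Knn n) :\: R.
Proof.
case/andP: RB_coloring => /eqP<- /disjoint_setI0 RB.
by rewrite setDUl setDv set0U; apply/esym/setDidPl; rewrite -setI_eq0 setIC RB.
Qed.

Lemma nbr_coloring (v : Knn n) :
  nbr R v \subset nb v /\ nbr B v = nb v :\: nbr R v.
Proof.
split; last by apply/setP=> u; rewrite coloring_complement !inE mem_edges.
by apply/subsetP=> u; rewrite !inE -mem_edges => /(subsetP coloring_subset).
Qed.

End Coloring.

Lemma card_nb_Knn (n : nat) (v : Knn n) : #|nb v| = n.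
Proof.
case: v => [x|y]; rewrite -[RHS]card_ord.
  rewrite -(card_imset 'I_n (@inr_inj 'I_n 'I_n)); congr #|pred_of_set _|.
  apply/setP=> -[x'|y'] /=; rewrite inE /=.
    by apply/esym/negP=> /imsetP[].
  by rewrite imset_f.
rewrite -(card_imset 'I_n (@inl_inj 'I_n 'I_n)); congr #|pred_of_set _|.
apply/setP=> -[x'|y'] /=; rewrite inE /=.
  by rewrite imset_f.
by apply/esym/negP=> /imsetP[].
Qed.

Lemma card_nbr_coloring (n : nat) (R B : {set {set Knn n}}) (v : Knn n) :
  coloring R B -> #|nbr R v| + #|nbr B v| = n.
Proof.
move=> /nbr_coloring /(_ v)[sub ->].
by rewrite -[RHS](card_nb_Knn v) -(cardsID (nbr R v) (nb v)) (setIidPr sub).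
Qed.

Lemma subset_card (T : finType) (A : {set T}) (a : nat) :
  a <= #|A| -> exists2 D : {set T}, D \subset A & #|D| = a.
Proof.
move=> aA; have := bin_gt0 #|A| a; rewrite aA -cards_draws => /card_gt0P[D].
by rewrite inE => /andP[sub /eqP]; exists D.
Qed.

(** If a balanced star had at most [m] edges of one color, it would have at most [m + 1] of the
    other, hence at most [2m + 1 < s] in all. The converse chooses leaves of each color. *)
Lemma balanced_star_degree (n m s : nat) (R B : {set {set Knn n}}) :
  m.*2.+2 <= s <= m.*2.+3 -> s <= n -> coloring R B ->
  has_balanced_copy (star s) R B <->
  exists v : Knn n, m < #|nbr R v| /\ m < #|nbr B v|.
Proof.
move=> s_m s_n RB; rewrite has_balanced_copy_starP; split.
  case=> v [N [sub Ns] [le1 le2]]; exists v.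
  have [_ E] := nbr_coloring RB v.
  have E1 : N :&: nbr B v = N :\: nbr R v.
    by rewrite E setIDA (setIidPl sub).
  have := cardsID (nbr R v) N; rewrite -E1 Ns.
  have := subset_leq_card (subsetIr N (nbr R v)).
  have := subset_leq_card (subsetIr N (nbr B v)).
  by lia.
case=> v [mR mB]; exists v; have [sub E] := nbr_coloring RB v.
have deg := card_nbr_coloring v RB.
(* [a] and [c] are the numbers of red and blue leaves to choose. For [s = 2m + 3] one color has
   degree at least [m + 2] at [v], since the two degrees add up to [n >= s]; the extra leaf is taken
   there. *)
have [a [c [aR cB ac [ac1 ca1]]]] : exists a c, [/\ a <= #|nbr R v|,
    c <= #|nbr B v|, a + c = s & a <= c.+1 /\ c <= a.+1].
  have [sE|sE] : s = m.*2.+2 \/ s = m.*2.+3 by lia.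
    by exists m.+1, m.+1; split; lia.
  have [lt|ge] := leqP m.+2 #|nbr R v|; first by exists m.+2, m.+1; split; lia.
  by exists m.+1, m.+2; split; lia.
have [A AR Aa] := subset_card aR; have [C CB Cc] := subset_card cB.
have dis : nbr R v :&: nbr B v = set0.
  by rewrite E setIDA setIC -setIDA setDv setI0.
have AC : A :&: C = set0.
  by apply/eqP; rewrite -subset0 -dis setISS.
have AB : A :&: nbr B v = set0.
  by apply/eqP; rewrite -subset0 -dis setISS.
have CR : C :&: nbr R v = set0.
  by apply/eqP; rewrite -subset0 -dis setIC setISS.
exists (A :|: C); first split.
- by rewrite subUset (subset_trans AR sub) (subset_trans CB) // E subsetDl.
- by rewrite cardsU AC cards0 Aa Cc; lia.
rewrite !setIUl AB CR setU0 set0U (setIidPl AR) (setIidPl CB) Aa Cc.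
by split.
Qed.

(** * Bipartite relations of extremal size *)

Definition rdeg (X Y : finType) (r : X -> Y -> bool) (x : X) : nat :=
  #|[set y | r x y]|.

Definition rsize (X Y : finType) (r : X -> Y -> bool) : nat :=
  #|[set p : X * Y | r p.1 p.2]|.

Definition rflip (X Y : Type) (r : X -> Y -> bool) (y : Y) (x : X) := r x y.

(** The extremal graph seen from one side, with equalities relaxed: there [P] has exactly [m]
    vertices, all of full degree, and the other vertices have degree exactly [m]. *)
Definition covers (X Y : finType) (r : X -> Y -> bool) (m : nat) (P : {set X}) :=
  #|P| <= m /\ forall x, x \notin P -> rdeg r x <= m.

Lemma rsize_sum (X Y : finType) (r : X -> Y -> bool) : rsize r = \sum_x rdeg r x.
Proof.
rewrite /rsize -sum1_card (eq_bigl (fun p => true && r p.1 p.2)).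
  rewrite -(pair_big_dep xpredT r (fun _ _ => 1)) /=.
  by apply: eq_bigr => x _; rewrite /rdeg -sum1_card; apply: eq_bigl => y; rewrite inE.
by move=> p; rewrite inE.
Qed.

Lemma rsize_flip (X Y : finType) (r : X -> Y -> bool) : rsize (rflip r) = rsize r.
Proof.
pose sw (p : X * Y) := (p.2, p.1).
have sw_inj : injective sw by move=> [x y] [x' y'] [-> ->].
rewrite /rsize -[RHS](card_imset _ sw_inj); congr #|pred_of_set _|.
apply/setP=> -[y x]; rewrite inE; apply/idP/imsetP=> [xy|[[x' y']]].
  by exists (x, y); rewrite ?inE.
by rewrite inE /= => ? [-> ->].
Qed.

(* Pairs of P x Q in r are counted from their end in Q, the others from their
   end in P. *)
Lemma cross_count (X Y : finType) (r r' : X -> Y -> bool) (m : nat)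
    (P : {set X}) (Q : {set Y}) :
    (forall x y, r' x y = ~~ r x y) ->
    (forall x, x \in P -> rdeg r' x <= m) ->
    (forall y, y \in Q -> rdeg (rflip r) y <= m) ->
  #|P| * #|Q| <= m * (#|P| + #|Q|).
Proof.
move=> r'E Pm Qm; pose F x y := [&& x \in P, y \in Q & r x y].
pose G x y := [&& x \in P, y \in Q & r' x y].
have -> : #|P| * #|Q| = rsize F + rsize G.
  rewrite -cardsX -(cardsID [set p | r p.1 p.2]) /rsize.
  congr (_ + _); apply: eq_card => p; rewrite !inE /F /G ?r'E !andbA //.
  by rewrite -andbA andbC.
have sumM (T : finType) (S : {set T}) (g : T -> nat) :
    (forall t, t \in S -> g t <= m) -> (forall t, t \notin S -> g t = 0) ->
    \sum_t g t <= m * #|S|.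
  move=> gm g0; rewrite (bigID (mem S)) /= [X in _ + X]big1 // addn0.
  by rewrite mulnC -sum_nat_const; apply: leq_sum.
rewrite ssrnat.mulnDr addnC leq_add //; last first.
  rewrite -rsize_flip rsize_sum; apply: sumM => y.
    move=> yQ; apply: leq_trans (Qm y yQ); apply: subset_leq_card.
    by apply/subsetP=> x; rewrite !inE => /and3P[].
  move=> yQ; apply: eq_card0 => x; rewrite !inE /rflip /F (negPf yQ).
  by rewrite andbF.
rewrite rsize_sum; apply: sumM => x.
  move=> xP; apply: leq_trans (Pm x xP); apply: subset_leq_card.
  by apply/subsetP=> y; rewrite !inE => /and3P[].
by move=> xP; apply: eq_card0 => y; rewrite !inE /G (negPf xP).
Qed.

(** The degrees are at most [n] on [P] and [m] off it, and [|P| n + (n - |P|) m] is strictly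
    increasing in [|P|] because [m < n]. At [|P| = m] it equals [2mn - m^2 = n^2 - (n - m)^2]. *)
Lemma covers_rsize (X Y : finType) (r : X -> Y -> bool) (m n : nat)
    (P : {set X}) :
  #|X| = n -> #|Y| = n -> m < n -> covers r m P ->
  rsize r <= n ^ 2 - (n - m) ^ 2 ?= iff
    (#|P| == m) && [forall x, rdeg r x == if x \in P then n else m].
Proof.
move=> Xn Yn mn [Pm Pr]; pose g x := if x \in P then n else m.
have bound := @leqif_sum _ xpredT _ (rdeg r) g.
have {}bound : rsize r <= \sum_x g x ?= iff [forall x, rdeg r x == g x].
  rewrite rsize_sum; apply: bound => x _; apply/leqif_eq; rewrite /g.
  by case: ifP => xP; [rewrite -Yn max_card | rewrite Pr ?xP].
have sumE : \sum_x g x = #|P| * n + (n - #|P|) * m.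
  rewrite (bigID (mem P)) /=; congr (_ + _).
    by rewrite -sum_nat_const; apply: eq_bigr => x xP; rewrite /g xP.
  have -> : n - #|P| = #|[predC P]| by rewrite -Xn -(cardC P) addKn.
  by rewrite -sum_nat_const; apply: eq_bigr => x xP; rewrite /g (negPf xP).
rewrite andbC; apply: leqif_trans bound _; rewrite sumE; split; first nia.
by apply/eqP/eqP => [|->]; nia.
Qed.

(** Equality in the counts from both sides makes all vertices of [P] and [Q] full. A vertex outside
    [P] then has exactly [m] neighbors, among them the [m] vertices of [Q], so its neighborhood is
    [Q]. *)
Lemma covers_extremal (X Y : finType) (r : X -> Y -> bool) (m n : nat)
    (P : {set X}) (Q : {set Y}) :
    #|X| = n -> #|Y| = n -> m < n -> covers r m P -> covers (rflip r) m Q ->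
    rsize r = n ^ 2 - (n - m) ^ 2 ->
  [/\ #|P| = m, #|Q| = m & forall x y, r x y = (x \in P) || (y \in Q)].
Proof.
move=> Xn Yn mn Pc Qc sz.
have [_] := covers_rsize Xn Yn mn Pc; rewrite sz eqxx => /esym/andP[/eqP Pm].
move=> /forallP Pd.
have [_] := covers_rsize Yn Xn mn Qc.
rewrite rsize_flip sz eqxx => /esym/andP[/eqP Qm] /forallP Qd.
have rP x y : x \in P -> r x y.
  move=> xP; have := Pd x; rewrite xP -Yn -cardsT => /eqP E.
  have /eqP/setP/(_ y) : [set y | r x y] == setT by rewrite eqEcard subsetT -E leqnn.
  by rewrite !inE.
have rQ x y : y \in Q -> r x y.
  move=> yQ; have := Qd y; rewrite yQ -Xn -cardsT => /eqP E.
  have /eqP/setP/(_ x) : [set x | rflip r y x] == setT.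
    by rewrite eqEcard subsetT -E leqnn.
  by rewrite !inE.
split=> // x y; case: (boolP (x \in P)) => [/rP-> //|xP] /=.
have := Pd x; rewrite (negPf xP) -Qm => /eqP E.
have /eqP/setP/(_ y) : Q == [set y | r x y].
  rewrite eqEcard; rewrite -[#|[set y | _]|]/(rdeg r x) E leqnn andbT.
  by apply/subsetP=> z zQ; rewrite inE rQ.
by rewrite inE => ->.
Qed.

(** The first hypothesis says [(a - m)(c - m) <= m^2]. Two positive integers with product at most
    [m^2] have sum at most [m^2 + 1], and adding [2m] gives [(m + 1)^2]. *)
Lemma cross_sum_bound (m a c : nat) :
  a * c <= m * (a + c) -> m < a -> m < c -> a + c <= m.+1 ^ 2.
Proof.
move=> ac ma mc; have [u uE] : exists u, a = m.+1 + u by exists (a - m.+1); lia.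
have [v vE] : exists v, c = m.+1 + v by exists (c - m.+1); lia.
by rewrite {}uE {}vE in ac *; nia.
Qed.

Lemma unbalanced_covers (X Y : finType) (r r' : X -> Y -> bool) (m n : nat) :
    #|X| = n -> #|Y| = n -> 2 * m.+1 ^ 2 + m.*2 <= n ->
    (forall x y, r' x y = ~~ r x y) ->
    (forall x, rdeg r x <= m \/ rdeg r' x <= m) ->
    (forall y, rdeg (rflip r) y <= m \/ rdeg (rflip r') y <= m) ->
  (exists P Q, covers r m P /\ covers (rflip r) m Q) \/
  (exists P Q, covers r' m P /\ covers (rflip r') m Q).
Proof.
move=> Xn Yn mn r'E rX rY.
pose P := [set x | m < rdeg r x]; pose Q := [set y | m < rdeg (rflip r) y].
have Pn := cardsC P; have Qn := cardsC Q; rewrite Xn Yn in Pn Qn.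
have P1 x : x \notin P -> rdeg r x <= m by rewrite inE -leqNgt.
have Q1 x : x \notin Q -> rdeg (rflip r) x <= m by rewrite inE -leqNgt.
have P2 x : x \in P -> rdeg r' x <= m.
  by rewrite inE; case: (rX x) => //; rewrite leqNgt => /negP.
have Q2 y : y \in Q -> rdeg (rflip r') y <= m.
  by rewrite inE; case: (rY y) => //; rewrite leqNgt => /negP.
have c1 : #|P| * #|~: Q| <= m * (#|P| + #|~: Q|).
  by apply: (cross_count r'E) => // y; rewrite inE; apply: Q1.
have c2 : #|~: P| * #|Q| <= m * (#|~: P| + #|Q|).
  apply: (@cross_count _ _ r' r) => // [x y|x]; first by rewrite r'E negbK.
  by rewrite inE => /P1.
have c1' := cross_sum_bound c1; have c2' := cross_sum_bound c2.
(* If [|P| <= m], then [~: P] has at least [n - m > (m + 1)^2] elements, so [c2'] forces [|Q| <= m];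
   the other sets behave alike. If all four sizes exceeded [m], adding [c1'] and [c2'] would give
   [2n <= 2(m + 1)^2]. With [m * m] abstracted, every case is linear. *)
have : (#|P| <= m /\ #|Q| <= m) \/ (#|~: P| <= m /\ #|~: Q| <= m).
  move: Pn Qn c1' c2' mn; clear; rewrite (_ : m.+1 ^ 2 = m * m + m.*2.+1); last by lia.
  move: (m * m) => mm.
  case: (leqP #|P| m) => h1; case: (leqP #|Q| m) => h2;
    case: (leqP #|~: P| m) => h3; case: (leqP #|~: Q| m) => h4; lia.
(* In the second case the colors trade places: the vertices outside [~: P] are those of [P], whose
   blue degree is at most [m]. *)
case=> [[Ple Qle]|[Ple Qle]]; [left; exists P, Q | right; exists (~: P), (~: Q)].
  by split; split.
by split; split=> // x; rewrite inE negbK => ?; [apply: P2 | apply: Q2].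
Qed.

(** * Edge sets of the complete bipartite graph *)

(** Turns a set of edges into a relation between the two sides, to which the counting applies. Pairs
    within one side are invisible to it, hence the hypothesis [S_sub] below. *)
Definition erel (n : nat) (S : {set {set Knn n}}) (x y : 'I_n) : bool :=
  [set inl x; inr y] \in S.

Section EdgeSet.
Variables (n : nat) (S : {set {set Knn n}}).
Hypothesis S_sub : S \subset edges (Knn n).

Lemma edge_set_adj (u v : Knn n) :
  ([set u; v] \in S) = bip_adj (erel S) u v.
Proof.
have uv_adj : [set u; v] \in S -> adj u v.
  by rewrite -mem_edges; apply: (subsetP S_sub).
case: u v uv_adj => [x|y] [x'|y'] uv_adj //=; [|by rewrite setUC|];
  by apply/negP=> /uv_adj.
Qed.

Lemma card_nbr_inl (x : 'I_n) : #|nbr S (inl x)| = rdeg (erel S) x.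
Proof.
rewrite /rdeg -[RHS](card_imset _ (@inr_inj 'I_n 'I_n)); apply: eq_card => u.
rewrite inE edge_set_adj; case: u => [x'|y'] /=; last first.
  by rewrite mem_imset ?inE //; apply: inr_inj.
by apply/esym/negP=> /imsetP[].
Qed.

Lemma card_nbr_inr (y : 'I_n) : #|nbr S (inr y)| = rdeg (rflip (erel S)) y.
Proof.
rewrite /rdeg -[RHS](card_imset _ (@inl_inj 'I_n 'I_n)); apply: eq_card => u.
rewrite inE edge_set_adj; case: u => [x'|y'] /=.
  by rewrite mem_imset ?inE //; apply: inl_inj.
by apply/esym/negP=> /imsetP[].
Qed.

Lemma card_edge_set : #|S| = rsize (erel S).
Proof.
pose e (p : 'I_n * 'I_n) : {set Knn n} := [set inl p.1; inr p.2].
have e_inj : injective e.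
  move=> [x y] [x' y'] /setP E.
  by have := E (inl x); have := E (inr y); rewrite !inE /= !eqxx ?orbT
    => /esym/eqP[->] /esym/orP[]// /eqP[->].
rewrite /rsize -[RHS](card_imset _ e_inj); apply: eq_card => A.
apply/idP/imsetP=> [AS|[p + ->]]; last by rewrite inE.
have /imsetP[[u v]] := subsetP S_sub A AS.
rewrite inE /=; case: u v => [x|y] [x'|y'] //= _ AE.
  by exists (x, y'); rewrite // inE /erel -AE.
by exists (x', y); rewrite ?inE /erel /e /= ?[[set inl _; _]]setUC -?AE.
Qed.

Lemma graph_of_edges_iso : graph_iso (graph_of_edges S) (bip_graph (erel S)).
Proof.
exists id; first by exists id.
move=> u v; rewrite /= /edge_adj edge_set_adj; case: eqVneq => //= ->.
by case: (v).
Qed.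

Lemma nbr_graph_of_edges (v : Knn n) : nbr S v = nb (v : graph_of_edges S).
Proof.
apply/setP=> u; rewrite !inE /= /edge_adj; case: eqVneq => //= <-.
by rewrite edge_set_adj; case: (v).
Qed.

End EdgeSet.

Lemma card_edges_graph_of_edges (n : nat) (S : {set {set Knn n}}) :
  S \subset edges (Knn n) -> #|edges (graph_of_edges S)| = #|S|.
Proof.
move=> S_sub; apply: eq_card => A; apply/imsetP/idP=> [[[u v]]|AS].
  by rewrite inE /= => /andP[_ uvS] ->.
have /imsetP[[u v]] := subsetP S_sub A AS; rewrite inE /= => uv AE.
exists (u, v) => //; rewrite inE /= /edge_adj -AE AS andbT.
by apply: contraTneq uv => ->; case: (v).
Qed.

(** * The extremal graph *)

Lemma set_sum_bij (T : finType) (A : {set T}) (a c : nat) :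
  #|A| = a -> #|~: A| = c ->
  exists2 f : T -> 'I_a + 'I_c, bijective f &
    forall x, (x \in A) = (if f x is inl _ then true else false).
Proof.
move=> Aa Ac.
pose g (u : 'I_a + 'I_c) : T := match u with
  | inl i => enum_val (cast_ord (esym Aa) i)
  | inr i => enum_val (cast_ord (esym Ac) i) end.
have gA u : (g u \in A) = (if u is inl _ then true else false).
  case: u => i; first exact: enum_valP.
  by apply/negbTE; rewrite -in_setC; apply: enum_valP.
have g_inj : injective g.
  move=> u v E; have := gA u; rewrite E gA.
  case: u v E => [i|i] [j|j] //= /enum_val_inj/cast_ord_inj -> //.
have [f fK gK] : bijective g.
  by apply: (inj_card_bij g_inj); rewrite card_sum !card_ord -(cardsC A) Aa Ac.
by exists f => [|x]; [exists g | rewrite -gA gK].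
Qed.

Lemma extremal_graph_iso (n m : nat) (P Q : {set 'I_n})
    (r : 'I_n -> 'I_n -> bool) :
  #|P| = m -> #|Q| = m -> (forall x y, r x y = (x \in P) || (y \in Q)) ->
  graph_iso (bip_graph r) (extremal_graph n m).
Proof.
move=> Pm Qm rE.
have setC_card (A : {set 'I_n}) : #|A| = m -> #|~: A| = n - m.
  by move=> Am; have := cardsC A; rewrite card_ord; lia.
(* [P] plays the part of [X2] and [Q] that of [Y1]. As [X1] is the left summand of [X], the
   bijection on that side is built from [~: P], and on the other side from [Q]. *)
have PCm : #|~: ~: P| = m by rewrite setCK.
have [f [f' fK f'K] fP] := set_sum_bij (setC_card _ Pm) PCm.
have [g [g' gK g'K] gQ] := set_sum_bij Qm (setC_card _ Qm).
pose h (u : 'I_n + 'I_n) : ('I_(n - m) + 'I_m) + ('I_m + 'I_(n - m)) :=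
  match u with inl x => inl (f x) | inr y => inr (g y) end.
pose h' (u : ('I_(n - m) + 'I_m) + ('I_m + 'I_(n - m))) : 'I_n + 'I_n :=
  match u with inl x => inl (f' x) | inr y => inr (g' y) end.
have hr x y : adj (h (inl x) : extremal_graph n m) (h (inr y)) = r x y.
  rewrite rE gQ -[x \in P]negbK -in_setC fP /=.
  by case: (f x); case: (g y).
exists (h : bip_graph r -> extremal_graph n m).
  by exists h' => -[u|u]; rewrite /= ?fK ?f'K ?gK ?g'K.
by move=> [x|y] [x'|y'] //; rewrite adj_sym; apply: hr.
Qed.

Section ExtremalColoring.
Variables (n m : nat).
Hypothesis m_le_n : m <= n.

(** A concrete choice of the [m] full vertices, the same on both sides. *)
Definition corner : {set 'I_n} := [set x : 'I_n | x < m].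

Lemma card_corner : #|corner| = m.
Proof.
have w_inj : injective (widen_ord m_le_n).
  by move=> x y /(congr1 val) /= /val_inj.
rewrite -[RHS]card_ord -(card_imset _ w_inj).
apply: eq_card => x; rewrite inE; apply/idP/imsetP=> [xm|[y _ ->]].
  by exists (Ordinal xm) => //; apply: val_inj.
by case: y.
Qed.

Definition extremal_rel (x y : 'I_n) : bool := (x \in corner) || (y \in corner).

Definition extremal_red : {set {set Knn n}} :=
  [set [set inl p.1; inr p.2] | p : 'I_n * 'I_n & extremal_rel p.1 p.2].

Lemma extremal_red_subset : extremal_red \subset edges (Knn n).
Proof. by apply/subsetP=> _ /imsetP[p _ ->]; rewrite mem_edges. Qed.

Lemma erel_extremal_red x y : erel extremal_red x y = extremal_rel x y.
Proof.
apply/imsetP/idP=> [[[x' y']]|xy]; last by exists (x, y); rewrite ?inE.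
rewrite inE /= => + /setP E.
by have := E (inl x); have := E (inr y); rewrite !inE /= !eqxx ?orbT
    => /esym/eqP[->] /esym/orP[]// /eqP[->].
Qed.

Lemma same_extremal_red :
  same_graph (graph_of_edges extremal_red) (extremal_graph n m).
Proof.
apply: same_graph_trans (graph_iso_same (graph_of_edges_iso extremal_red_subset)) _.
apply: graph_iso_same.
exact: (extremal_graph_iso card_corner card_corner erel_extremal_red).
Qed.

Lemma card_extremal_red : #|extremal_red| = n ^ 2 - (n - m) ^ 2.
Proof.
rewrite (card_edge_set extremal_red_subset) /rsize.
have := cardsC [set p : 'I_n * 'I_n | erel extremal_red p.1 p.2].
have -> : ~: [set p : 'I_n * 'I_n | erel extremal_red p.1 p.2] =
          setX (~: corner) (~: corner).
  by apply/setP=> p; rewrite !inE erel_extremal_red /extremal_rel !inE negb_or.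
rewrite cardsX card_prod !card_ord.
have := cardsC corner; rewrite card_corner card_ord.
move=> cE; rewrite (_ : #|~: corner| = n - m); last by lia.
by rewrite -!mulnn => <-; rewrite addnK.
Qed.

Lemma card_nb_extremal_red (v : graph_of_edges extremal_red) :
  #|nb v| = m \/ #|nb v| = n.
Proof.
rewrite -(nbr_graph_of_edges extremal_red_subset).
have rowE (r : 'I_n -> 'I_n -> bool) x :
    (forall y, r x y = (x \in corner) || (y \in corner)) ->
    rdeg r x = m \/ rdeg r x = n.
  move=> rE; case: (boolP (x \in corner)) => xP.
    right; rewrite /rdeg -[RHS]card_ord; apply: eq_card => y.
    by rewrite inE rE xP.
  left; rewrite /rdeg -[RHS]card_corner; apply: eq_card => y.
  by rewrite inE rE (negPf xP).
case: v => [x|y].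
  rewrite (card_nbr_inl extremal_red_subset).
  by apply: rowE => y; apply: erel_extremal_red.
rewrite (card_nbr_inr extremal_red_subset); apply: rowE => x.
by rewrite /rflip erel_extremal_red /extremal_rel orbC.
Qed.

End ExtremalColoring.

(** Degrees of non-isolated vertices can be read off the concrete copy [extremal_red], where they
    are [m] or [n]. Isolated vertices have degree 0, which is why the first alternative is an
    inequality. *)
Lemma same_extremal_degree (n m : nat) (S : {set {set Knn n}}) (v : Knn n) :
    m <= n -> S \subset edges (Knn n) ->
    same_graph (graph_of_edges S) (extremal_graph n m) ->
  #|nbr S v| <= m \/ #|nbr S v| = n.
Proof.
move=> mn S_sub SH; rewrite nbr_graph_of_edges //.
have /same_graph_card_nb := same_graph_trans SH (same_graph_sym (same_extremal_red mn)).
case/(_ v)=> [->|[w <-]]; first by rewrite cards0; left.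
by case: (card_nb_extremal_red mn w) => ->; [left | right].
Qed.

(** * The bipartite balancing number *)

Section Extremal.
Variables (n m : nat).
(** For [k = 2m + 2] this is the bound [n >= k^2 / 2 + k - 2]. *)
Hypothesis n_ge : 2 * m.+1 ^ 2 + m.*2 <= n.

Let b := n ^ 2 - (n - m) ^ 2.
Let H := extremal_graph n m.

Lemma m_lt_n : m < n.
Proof. by move: n_ge; nia. Qed.

Lemma extremal_size_bound : b < n ^ 2 %/ 2.
Proof.
rewrite /b leq_divRL //.
(* With [q = n - m] one has [b = n^2 - q^2], so the goal amounts to [n^2 + 2 <= 2 q^2]; the linear
   bound [q >= 5m + 2] suffices for it. *)
have [q qE] : exists q, n = q + m by exists (n - m); move: m_lt_n; lia.
have q_ge : 5 * m + 2 <= q by move: n_ge; rewrite qE; nia.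
rewrite qE addnK -!mulnn; nia.
Qed.

Lemma coloring_size (R B : {set {set Knn n}}) :
  coloring R B -> #|R| + #|B| = n ^ 2.
Proof.
move=> RB; rewrite (coloring_complement RB).
have R_sub := coloring_subset RB.
rewrite -{1}(setIidPr R_sub) cardsID (card_edge_set (subxx _)) rsize_sum.
rewrite (eq_bigr (fun _ => n)) ?sum_nat_const ?card_ord ?mulnn // => x _.
rewrite -(card_nbr_inl (subxx _)) -[RHS](card_nb_Knn (inl x : Knn n)).
by apply: eq_card => u; rewrite !inE mem_edges.
Qed.

Lemma coloring_complement_set (S : {set {set Knn n}}) :
  S \subset edges (Knn n) -> coloring S (edges (Knn n) :\: S).
Proof.
move=> S_sub; apply/andP; split; first by rewrite -{1}(setIidPr S_sub) setID.
by rewrite -setI_eq0 setIDA setDIl setDv set0I.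
Qed.

Lemma covers_edge_set (S : {set {set Knn n}}) (P Q : {set 'I_n}) :
    S \subset edges (Knn n) -> covers (erel S) m P -> covers (rflip (erel S)) m Q ->
  #|S| <= b /\ (#|S| = b -> same_graph (graph_of_edges S) H).
Proof.
move=> S_sub Pc Qc; rewrite (card_edge_set S_sub).
have [le _] := covers_rsize (card_ord n) (card_ord n) m_lt_n Pc.
split=> // sz; apply: same_graph_trans (graph_iso_same (graph_of_edges_iso S_sub)) _.
have [Pm Qm rE] := covers_extremal (card_ord n) (card_ord n) m_lt_n Pc Qc sz.
exact/graph_iso_same/(extremal_graph_iso Pm Qm rE).
Qed.

(** Serves twice: the inequality shows that more than [b] edges in each color force a balanced copy,
    the equality case identifies the extremal colorings. *)
Lemma unbalanced_coloring (R B : {set {set Knn n}}) :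
    coloring R B -> (forall v, #|nbr R v| <= m \/ #|nbr B v| <= m) ->
  (#|R| <= b /\ (#|R| = b -> same_graph (graph_of_edges R) H)) \/
  (#|B| <= b /\ (#|B| = b -> same_graph (graph_of_edges B) H)).
Proof.
move=> RB deg; have R_sub := coloring_subset RB.
have B_sub := coloring_subset (coloring_sym RB).
have BE x y : erel B x y = ~~ erel R x y.
  by rewrite /erel (coloring_complement RB) inE mem_edges andbT.
have rX x : rdeg (erel R) x <= m \/ rdeg (erel B) x <= m.
  by rewrite -!card_nbr_inl.
have rY y : rdeg (rflip (erel R)) y <= m \/ rdeg (rflip (erel B)) y <= m.
  by rewrite -!card_nbr_inr.
case: (unbalanced_covers (card_ord n) (card_ord n) n_ge BE rX rY) => -[P [Q [Pc Qc]]].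
  by left; apply: covers_edge_set Pc Qc.
by right; apply: covers_edge_set Pc Qc.
Qed.

Lemma extremal_coloring_degree (R B : {set {set Knn n}}) (v : Knn n) :
    coloring R B -> same_graph (graph_of_edges R) H ->
  #|nbr R v| <= m \/ #|nbr B v| <= m.
Proof.
move=> RB RH; have := card_nbr_coloring v RB.
case: (same_extremal_degree v (ltnW m_lt_n) (coloring_subset RB) RH); first by left.
by move=> -> /(canRL (addKn n)) ->; rewrite subnn; right.
Qed.

(** * Graphs whose balanced copies are detected by a vertex of large degree in both colors *)

Section Criterion.
Variable G : sgraph.
(** Stated for an abstract [G] so that the stars with [k] and with [k + 1] edges are handled by one
    argument. *)
Hypothesis G_balanced : forall R B : {set {set Knn n}}, coloring R B ->
  (has_balanced_copy G R B <-> exists v, m < #|nbr R v| /\ m < #|nbr B v|).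

Lemma not_balancedP (R B : {set {set Knn n}}) : coloring R B ->
  ~ has_balanced_copy G R B <-> forall v, #|nbr R v| <= m \/ #|nbr B v| <= m.
Proof.
move=> RB; rewrite G_balanced //; split=> [nbal v|deg [v [vR vB]]].
  have [|vR] := leqP #|nbr R v| m; first by left.
  have [|vB] := leqP #|nbr B v| m; first by right.
  by case: nbal; exists v.
by case: (deg v); rewrite leqNgt ?vR ?vB.
Qed.

Lemma not_balanced_extremalP (R B : {set {set Knn n}}) : coloring R B ->
    b <= #|R| -> b <= #|B| -> #|R| = b \/ #|B| = b ->
  ~ has_balanced_copy G R B <->
  same_graph (graph_of_edges R) H \/ same_graph (graph_of_edges B) H.
Proof.
move=> RB Rb Bb _; rewrite not_balancedP //; split.
  case/(unbalanced_coloring RB) => -[le eqH]; [left | right]; apply: eqH.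
    by apply/eqP; rewrite eqn_leq le.
  by apply/eqP; rewrite eqn_leq le.
case=> [RH|BH] v; first exact: extremal_coloring_degree RH.
by apply/or_comm; apply: extremal_coloring_degree BH; apply: coloring_sym.
Qed.

Lemma forces_balanced_bound : forces_balanced n G b.
Proof.
apply/forallP=> R; apply/forallP=> B; apply/implyP=> /and3P[RB Rb Bb].
case: (boolP (has_balanced_copy G R B)) => // /negP.
move/(not_balancedP RB)/(unbalanced_coloring RB).
by case=> -[]; rewrite leqNgt ?Rb ?Bb.
Qed.

(** The complement has [n^2 - b] edges and [b] is below half of [n^2]. So when one color has [b]
    edges, the other is too large to be the extremal graph. *)
Lemma complement_size (S : {set {set Knn n}}) :
  S \subset edges (Knn n) -> #|S| = b -> b < #|edges (Knn n) :\: S|.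
Proof.
move=> S_sub Sb; have := coloring_size (coloring_complement_set S_sub).
by have := extremal_size_bound; rewrite Sb; lia.
Qed.

Lemma extremal_red_unbalanced :
  ~ has_balanced_copy G (extremal_red n m) (edges (Knn n) :\: extremal_red n m).
Proof.
have RB := coloring_complement_set (extremal_red_subset n m).
apply/(not_balancedP RB) => v; apply: extremal_coloring_degree => //.
exact: same_extremal_red (ltnW m_lt_n).
Qed.

Lemma forces_balanced_lt (j : nat) : j < b -> ~~ forces_balanced n G j.
Proof.
move=> jb; apply/negP=> /forallP/(_ (extremal_red n m)).
move/forallP/(_ (edges (Knn n) :\: extremal_red n m))/implyP=> bal.
apply: extremal_red_unbalanced; apply: bal.
have sub := extremal_red_subset n m; have sz := card_extremal_red (ltnW m_lt_n).
have := complement_size sub sz.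
by rewrite coloring_complement_set // sz -/b; lia.
Qed.

Lemma bbal_eq : bbal n G = Some b.
Proof.
rewrite /bbal; have bN := extremal_size_bound.
(* The range is cut at [b]: filtering empties the part below [b], and the remaining part starts with
   [b] itself, which is kept. *)
rewrite -(subnKC bN) addSnnS iotaD filter_cat add0n.
rewrite (eq_in_filter (a2 := pred0)).
  by rewrite filter_pred0 /= forces_balanced_bound.
by move=> j; rewrite mem_iota => /= jb; apply/negbTE/forces_balanced_lt.
Qed.

Lemma is_Bbal_only_member (F : sgraph -> Prop) :
  is_Bbal n G F <-> only_member H F.
Proof.
have red_sub := extremal_red_subset n m.
have red_same := same_extremal_red (ltnW m_lt_n).
have red_size := card_extremal_red (ltnW m_lt_n).
rewrite /is_Bbal bbal_eq; split=> [[_ [<-] [F_same F_size F_sub F_char]]|FH].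
  (* Both sides characterize the coloring by [S] and its complement as having no balanced copy. The
     alternative for the complement is void, as [H] and the members of [F] have only [b] edges. *)
  have char (S : {set {set Knn n}}) : S \subset edges (Knn n) -> #|S| = b ->
      same_graph (graph_of_edges S) H <->
      exists2 J, F J & same_graph (graph_of_edges S) J.
    move=> S_sub Sb; have Cb := complement_size S_sub Sb.
    have RB := coloring_complement_set S_sub.
    have C_size J : same_graph (graph_of_edges (edges (Knn n) :\: S)) J ->
        #|edges J| <> b.
      move/same_graph_card_edges <-; rewrite card_edges_graph_of_edges ?subsetDl //.
      by move=> E; rewrite E ltnn in Cb.
    have b1 : b <= #|S| by rewrite Sb.
    have H1 := not_balanced_extremalP RB b1 (ltnW Cb) (or_introl Sb).
    have H2 := F_char _ _ RB b1 (ltnW Cb) (or_introl Sb).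
    have H_size : #|edges H| = b.
      by rewrite -(same_graph_card_edges red_same) card_edges_graph_of_edges.
    split=> [SH|[J FJ SJ]].
      have [J FJ [SJ|/C_size[]]] := proj1 H2 (proj2 H1 (or_introl SH)).
        by exists J.
      exact: F_size.
    by have [|/C_size[]] := proj1 H1 (proj2 H2 (ex_intro2 _ _ J FJ (or_introl SJ))).
  move=> J; split=> [FJ|JH].
    have [S S_sub JS] := F_sub J FJ.
    have Sb : #|S| = b.
      by rewrite -(F_size J FJ) (same_graph_card_edges JS) card_edges_graph_of_edges.
    apply: (same_graph_trans JS); apply: (proj2 (char _ S_sub Sb)).
    by exists J => //; apply: same_graph_sym JS.
  (* The extremal coloring puts some copy of [H] into [F]; closure under [same_graph] then brings in
     [J]. *)
  have [J' FJ' J'H] := proj1 (char _ red_sub red_size) red_same.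
  apply: F_same FJ'; apply: same_graph_trans (same_graph_sym J'H) _.
  exact: same_graph_trans red_same (same_graph_sym JH).
exists b => //; split.
- by move=> J J' JJ' /FH JH; apply/FH/(same_graph_trans (same_graph_sym JJ')).
- move=> J /FH JH; rewrite (same_graph_card_edges JH).
  by rewrite -(same_graph_card_edges red_same) card_edges_graph_of_edges.
- move=> J /FH JH; exists (extremal_red n m) => //.
  exact: same_graph_trans JH (same_graph_sym red_same).
move=> R B RB Rb Bb RBb; rewrite not_balanced_extremalP //; split.
  by move=> RBH; exists H => //; apply/FH/graph_iso_same; exists id; [exists id|].
case=> J /FH JH [RJ|BJ]; [left | right].
  exact: same_graph_trans RJ JH.
exact: same_graph_trans BJ JH.
Qed.

End Criterion.
End Extremal.

Theorem theorem13 (n k : nat) (k_even : ~~ odd k) (k_ge2 : 2 <= k)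
    (n_ge : k ^ 2 %/ 2 + k - 2 <= n) :
  exists b : nat,
    [/\ (b%:R = (k%:R - 2%:R) * (n%:R - (k%:R - 2%:R) / 4%:R) :> rat)%R,
        bbal n (star k) = Some b,
        forall F : sgraph -> Prop,
          is_Bbal n (star k) F <->
          only_member (extremal_graph n ((k - 2) %/ 2)) F &
        (n, k) != (2, 2) ->
        bbal n (star k.+1) = Some b /\
        forall F : sgraph -> Prop,
          is_Bbal n (star k.+1) F <->
          only_member (extremal_graph n ((k - 2) %/ 2)) F].
Proof.
have [m kE] : exists m, k = m.*2.+2 by exists (k./2.-1); lia.
have mE : (k - 2) %/ 2 = m by lia.
(* The division by 2 is exact since [k] is even: [k^2 = 2 * (2 (m + 1)^2)]. *)
have {}n_ge : 2 * m.+1 ^ 2 + m.*2 <= n.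
  apply: leq_trans n_ge; rewrite kE (_ : m.*2.+2 ^ 2 = 2 * m.+1 ^ 2 * 2); last by nia.
  by rewrite mulnK //; lia.
have m_n := m_lt_n n_ge.
have crit s (s_m : m.*2.+2 <= s <= m.*2.+3) (s_n : s <= n) R B :=
  @balanced_star_degree n m s R B s_m s_n.
have k_crit : forall R B : {set {set Knn n}}, coloring R B ->
    has_balanced_copy (star k) R B <->
    exists v, m < #|nbr R v| /\ m < #|nbr B v|.
  by apply: crit; rewrite kE; nia.
rewrite mE; exists (n ^ 2 - (n - m) ^ 2); split.
- rewrite kE; have -> : n ^ 2 - (n - m) ^ 2 = m * (n - m) + m * n by nia.
  rewrite natrD !natrM natrB 1?ltnW // -[m.*2.+2]addn2 natrD -muln2 natrM.
  by field.
- exact: bbal_eq.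
- by move=> F; apply: is_Bbal_only_member.
move=> nk; have k1_crit : forall R B : {set {set Knn n}}, coloring R B ->
    has_balanced_copy (star k.+1) R B <->
    exists v, m < #|nbr R v| /\ m < #|nbr B v|.
  apply: crit; first by rewrite kE; lia.
  (* The star with [2m + 3] edges must fit at a vertex of degree [n]. For [m >= 1] the bound on [n]
     ensures this; for [m = 0] it gives only [n >= 2], and [K_{2,2}] contains no star with three
     edges, whence the exclusion of [(2, 2)]. *)
  case: m kE n_ge {mE m_n k_crit} => [|m] kE n_ge; last by rewrite kE; nia.
  by move: nk n_ge; rewrite kE xpair_eqE; lia.
split; first exact: bbal_eq.
by move=> F; apply: is_Bbal_only_member.
Qed.
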